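(* Let $X$ be a compact Hausdorff space and let $\varphi_{0,\infty}=\{\varphi_j\}_{j=0}^{\infty}$ be a sequence of (arbitrary) multivalued maps $\varphi_j: X\multimap X$, $j\in\mathbb{N}\cup\{0\}$. Then $h_{\mathrm{KTRT}}(\varphi_{0,\infty})=h_{\mathrm{AKEK}}(\varphi_{0,\infty})$.
   Context: A uniformity on a nonempty set $S$ is a nonempty family $\mathcal{U}$ of pseudometrics on $S$ such that: (U1) if $p_0,p_1\in\mathcal{U}$, then $\max\{p_0,p_1\}\in\mathcal{U}$; (U2) if $p$ is a pseudometric on $S$ such that for every $\varepsilon>0$ there exist $p_\varepsilon\in\mathcal{U}$ and $\delta>0$ with $p_\varepsilon(x,y)<\delta\Rightarrow p(x,y)<\varepsilon$ for all $x,y\in S$, then $p\in\mathcal{U}$; (U3) if $x\neq y$ in $S$, then $p(x,y)>0$ for some $p\in\mathcal{U}$. The induced topology has as base the balls $B_p(x,r)=\{y: p(x,y)<r\}$, $p\in\mathcal{U}$, $r>0$. Every (nonempty) compact Hausdorff space carries a unique uniformity $\mathcal{U}$ inducing its topology, and this $\mathcal{U}$ is used below. A multivalued map $\varphi:X\multimap X$ assigns to each $x\in X$ a nonempty subset $\varphi(x)\subset X$ (no regularity is assumed). $\mathrm{Orb}_1(\varphi_{0,\infty})=X$ and, for $n\ge 2$, $\mathrm{Orb}_n(\varphi_{0,\infty})=\{(x_0,\ldots,x_{n-1})\in X^n: x_{i+1}\in\varphi_i(x_i),\ i=0,\ldots,n-2\}$. For $p\in\mathcal{U}$ put $p_n((x_i),(y_i))=\max_{0\le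 i\le n-1}p(x_i,y_i)$ on $X^n$. Let $s(\varphi_{0,\infty},p,\varepsilon,n)$ be the largest cardinality of a set $S\subset\mathrm{Orb}_n(\varphi_{0,\infty})$ with $p_n(\bar x,\bar y)>\varepsilon$ for all distinct $\bar x,\bar y\in S$, and let $r(\varphi_{0,\infty},p,\varepsilon,n)$ be the smallest cardinality of a set $R\subset\mathrm{Orb}_n(\varphi_{0,\infty})$ such that every $\bar y\in\mathrm{Orb}_n(\varphi_{0,\infty})$ has some $\bar x\in R$ with $p_n(\bar x,\bar y)\le\varepsilon$ (both are finite). Then $$h_{\mathrm{KTRT}}(\varphi_{0,\infty})=\sup_{p\in\mathcal{U},\varepsilon>0}\limsup_{n\to\infty}\frac1n\log s(\varphi_{0,\infty},p,\varepsilon,n)=\sup_{p\in\mathcal{U},\varepsilon>0}\limsup_{n\to\infty}\frac1n\log r(\varphi_{0,\infty},p,\varepsilon,n)$$ (the two expressions coincide). For an open cover $\mathcal{A}$ of $X$ let $\mathcal{A}^n=\{U_0\times\cdots\times U_{n-1}: U_0,\ldots,U_{n-1}\in\mathcal{A}\}$, and let $N(\varphi_{0,\infty},\mathcal{A},n)$ be the minimal cardinality of a subfamily of $\mathcal{A}^n$ covering $\mathrm{Orb}_n(\varphi_{0,\infty})$. Then $$h_{\mathrm{AKEK}}(\varphi_{0,\infty})=\sup_{\mathcal{A}}\limsup_{n\to\infty}\frac1n\log N(\varphi_{0,\infty},\mathcal{A},n),$$ the supremum being over all open covers $\mathcal{A}$ of $X$. *)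

(* Defs.v *)
From mathcomp Require Export all_boot all_order all_algebra.
From mathcomp Require Export all_classical all_reals all_analysis.

Set Implicit Arguments.
Unset Strict Implicit.
Unset Printing Implicit Defensive.

Import Order.TTheory GRing.Theory Num.Theory.
Import numFieldNormedType.Exports.
Local Open Scope card_scope.
Local Open Scope classical_set_scope.
Local Open Scope ring_scope.

Section Uniformity.
Context {R : realType}.

Definition is_pseudometric (S : Type) (p : S -> S -> R) : Prop :=
  [/\ forall x y, 0 <= p x y,
      forall x, p x x = 0,
      forall x y, p x y = p y x &
      forall x y z, p x z <= p x y + p y z].

(* The pseudometric formulation of a (separated) uniformity, as opposed to the
   entourage formulation of the library's uniformType. *)
Record is_uniformity (S : Type) (U : set (S -> S -> R)) : Prop := IsUniformity {
  uniformity_pseudometric : forall p, U p -> is_pseudometric p ;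
  uniformity_nonempty : U !=set0 ;
  uniformity_max : forall p0 p1, U p0 -> U p1 ->
    U (fun x y => Num.max (p0 x y) (p1 x y)) ;
  uniformity_saturated : forall p, is_pseudometric p ->
    (forall e : R, 0 < e -> exists pe : S -> S -> R, exists d : R,
      [/\ U pe, 0 < d & forall x y, pe x y < d -> p x y < e]) ->
    U p ;
  uniformity_separated : forall x y, x <> y -> exists2 p, U p & 0 < p x y
}.

Definition pball (S : Type) (p : S -> S -> R) (x : S) (r : R) : set S :=
  [set y | p x y < r].

Definition induces_topology (X : topologicalType) (U : set (X -> X -> R)) :
    Prop :=
  basis [set B : set X | exists p x r,
    [/\ U p, 0 < r & B = pball p x r]].

End Uniformity.

(* Points of X^n are functions 'I_n -> X; for n = 1 the condition is void, so
   that Orb phi 1 is all of X^1. *)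
Definition Orb (X : Type) (phi : nat -> X -> set X) (n : nat) :
    set ('I_n -> X) :=
  [set x | forall i j : 'I_n, j = i.+1 :> nat -> phi i (x i) (x j)].
Arguments Orb {X} phi n _.

Section Entropy.
Context {R : realType}.
Local Open Scope ereal_scope.

(* The cardinalities k of the finite sets in a family, as extended reals. The
   supremum (infimum) of such a set is the largest (smallest) cardinality when
   there is one; it is +oo if the cardinalities are unbounded (if the family has
   no finite member). *)
Definition cardinalities (T : Type) (F : set (set T)) : set (\bar R) :=
  [set (k%:R)%:E | k in [set k : nat | exists2 S, F S & S #= `I_k]].

Definition growth_rate (a : nat -> \bar R) : \bar R :=
  limn_esup (fun n => ((n%:R)^-1)%:E * lne (a n)).

(* All values of a pseudometric are nonnegative, so 0 is a neutral default. *)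
Definition pmax (X : Type) (p : X -> X -> R) (n : nat) (x y : 'I_n -> X) : R :=
  \big[Num.max/0%R]_(i < n) p (x i) (y i).

Definition separated_set (X : Type) (phi : nat -> X -> set X)
    (p : X -> X -> R) (e : R) (n : nat) (S : set ('I_n -> X)) : Prop :=
  S `<=` Orb phi n /\
  forall x y, S x -> S y -> x <> y -> (e < pmax p x y)%R.

Definition spanning_set (X : Type) (phi : nat -> X -> set X)
    (p : X -> X -> R) (e : R) (n : nat) (S : set ('I_n -> X)) : Prop :=
  S `<=` Orb phi n /\
  forall y, Orb phi n y -> exists2 x, S x & (pmax p x y <= e)%R.

Definition sep_number (X : Type) (phi : nat -> X -> set X)
    (p : X -> X -> R) (e : R) (n : nat) : \bar R :=
  ereal_sup (cardinalities [set S | separated_set phi p e (n := n) S]).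

Definition span_number (X : Type) (phi : nat -> X -> set X)
    (p : X -> X -> R) (e : R) (n : nat) : \bar R :=
  ereal_inf (cardinalities [set S | spanning_set phi p e (n := n) S]).

Definition hKTRT_sep (X : Type) (U : set (X -> X -> R))
    (phi : nat -> X -> set X) : \bar R :=
  ereal_sup [set h | exists p e, [/\ U p, (0 < e)%R &
    h = growth_rate (sep_number phi p e)]].

Definition hKTRT_span (X : Type) (U : set (X -> X -> R))
    (phi : nat -> X -> set X) : \bar R :=
  ereal_sup [set h | exists p e, [/\ U p, (0 < e)%R &
    h = growth_rate (span_number phi p e)]].

Definition open_cover (X : topologicalType) (A : set (set X)) : Prop :=
  A `<=` open /\ \bigcup_(V in A) V = [set: X].

Definition cover_power (X : Type) (A : set (set X)) (n : nat) :
    set (set ('I_n -> X)) :=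
  [set B | exists2 V : 'I_n -> set X, (forall i, A (V i)) &
    B = [set x | forall i, V i (x i)]].
Arguments cover_power {X} A n _.

Definition cover_number (X : Type) (phi : nat -> X -> set X)
    (A : set (set X)) (n : nat) : \bar R :=
  ereal_inf (cardinalities [set F : set (set ('I_n -> X)) |
    F `<=` cover_power A n /\ Orb phi n `<=` \bigcup_(B in F) B]).

Definition hAKEK (X : topologicalType) (phi : nat -> X -> set X) : \bar R :=
  ereal_sup [set growth_rate (cover_number phi A) | A in [set A | open_cover A]].

End Entropy.

(* Main.v *)
Require Import Defs.
Set Implicit Arguments.
Unset Strict Implicit.
Unset Printing Implicit Defensive.
Import Order.TTheory GRing.Theory Num.Theory.
Local Open Scope classical_set_scope.
Local Open Scope ring_scope.

(** The two entropies agree because, at well chosen scales, the three counting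
    numbers bound one another for each length [n] separately:
    - a finite separated set that cannot be enlarged is spanning, and if every
      one can be enlarged then the separation number is infinite, so
      [span_number phi p e n <= sep_number phi p e n] ([span_le_sep]);
    - a box of a cover by sets of [p]-diameter at most [e] contains at most one
      point of an [e]-separated set, so
      [sep_number phi p e n <= cover_number phi A n] ([sep_le_cover]);
    - if [e] is a Lebesgue number of the cover [A] for [p], each closed
      [pmax p]-ball of radius [e] lies in a box of [A], so
      [cover_number phi A n <= span_number phi p e n] ([cover_le_span]).

    The growth rate is monotone in the sequence of numbers.  For given [p] and
    [e], the [p]-balls of radius [e / 2] form an open cover to which the second
    bound applies; for a given open cover, compactness of [X] and stability of
    the uniformity under [max] give a single [p] and a Lebesgue number
    ([lebesgue_number]), to which the third bound applies.  Hence
    [hAKEK phi <= hKTRT_span U phi <= hKTRT_sep U phi <= hAKEK phi]. *)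

Section Counting.
Context {R : realType}.
Local Open Scope card_scope.

Lemma cardinalities_ge0 (T : Type) (F : set (set T)) (a : \bar R) :
  cardinalities F a -> (0 <= a)%E.
Proof. by move=> [k _ <-]; rewrite lee_fin ler0n. Qed.

Lemma le_growth_rate (a b : nat -> \bar R) :
  (forall n, 0 <= a n)%E -> (forall n, a n <= b n)%E ->
  (growth_rate a <= growth_rate b)%E.
Proof.
move=> a0 ab; rewrite /growth_rate !limn_esup_lim.
apply: lee_lim; [exact: is_cvg_esups|exact: is_cvg_esups|].
apply: nearW => m; apply/ereal_supP => _ [n /= mn <-].
apply: (@le_trans _ _ ((n%:R^-1)%:E * lne (b n))%E).
  apply: lee_wpmul2l; first by rewrite lee_fin invr_ge0 ler0n.
  rewrite lee_lne ?in_itv /= ?leey ?andbT //.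
  exact: le_trans (a0 n) (ab n).
by apply: ereal_sup_ubound; exists n.
Qed.

Lemma injective_card_le (T T' : Type) (A : set T) (B : set T') (f : T -> T') :
  (forall x, A x -> B (f x)) ->
  (forall x y, A x -> A y -> f x = f y -> x = y) -> A #<= B.
Proof.
move=> fAB finj.
have fA : f @` A #= A.
  apply: inj_card_eq => x y /set_mem Ax /set_mem Ay; exact: finj.
rewrite -(card_le_eql fA); apply: subset_card_le => _ [x Ax <-].
exact: fAB.
Qed.

Section Orbits.
Context {X : Type} (phi : nat -> X -> set X).
Implicit Types (p : X -> X -> R) (e : R) (A : set (set X)).

Lemma pmax_le p e n (x y : 'I_n -> X) : 0 <= e ->
  pmax p x y <= e <-> forall i, p (x i) (y i) <= e.
Proof.
move=> e0; split=> [h i|h]; last by apply: bigmax_le.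
by apply: le_trans h; exact: (le_bigmax _ (fun i => p (x i) (y i))).
Qed.

Lemma separated_set0 p e n : separated_set phi p e (n := n) set0.
Proof. by split. Qed.

Lemma sep_number_ge0 p e n : (0 <= sep_number phi p e n)%E.
Proof.
apply: ereal_sup_ubound; exists 0%N => //.
exists set0; first exact: separated_set0.
by rewrite II0 card_eq00.
Qed.

Lemma span_number_ge0 p e n : (0 <= span_number phi p e n)%E.
Proof. by apply/ereal_infP => a /cardinalities_ge0. Qed.

Lemma cover_number_ge0 A n : (0 <= cover_number phi A n :> \bar R)%E.
Proof. by apply/ereal_infP => a /cardinalities_ge0. Qed.

(** Two points of a common box are within [e] of each other in every
    coordinate, so sending each point of a separated set to a box that contains
    it is injective. *)
Lemma sep_le_cover p e A n : 0 <= e ->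
  (forall V x y, A V -> V x -> V y -> p x y <= e) ->
  (sep_number phi p e n <= cover_number phi A n)%E.
Proof.
move=> e0 diam; apply/ereal_supP => _ [k [S [SO Ssep] Sk] <-].
apply/ereal_infP => _ [m [F [FA OF] Fm] <-].
rewrite lee_fin ler_nat -card_le_II -(card_le_eql Sk) -(card_le_eqr Fm).
have [f fP] : {f : ('I_n -> X) -> set ('I_n -> X) &
    forall x, S x -> F (f x) /\ f x x}.
  apply: (choice (P := fun x B => S x -> F B /\ B x)) => x.
  have [Sx|nSx] := pselect (S x); last by exists set0.
  by have [B FB Bx] := OF _ (SO _ Sx); exists B.
apply: (injective_card_le (f := f)) => [x /fP[]//|x y Sx Sy fxy].
have [//|xy] := pselect (x = y).
have [Ffx fx] := fP _ Sx; have [_ fy] := fP _ Sy.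
have [V AV fV] := FA _ Ffx.
have := Ssep _ _ Sx Sy xy; rewrite ltNge => /negP[].
apply/pmax_le => // i; apply: (diam (V i)) => //.
  by move: fx; rewrite fV; exact.
by move: fy; rewrite -fxy fV; exact.
Qed.

(** A separated set with fewer points than any spanning set is not spanning,
    so it can be enlarged by an orbit that it does not span. *)
Lemma separated_set_extend p e n (S : set ('I_n -> X)) k :
  0 <= e -> is_pseudometric p -> separated_set phi p e S -> S #= `I_k ->
  (k%:R%:E < span_number phi p e n)%E ->
  exists2 S' : set ('I_n -> X), separated_set phi p e S' & S' #= `I_k.+1.
Proof.
move=> e0 [_ pxx psym _] [SO Ssep] Sk kspan.
have [z Oz zS] : exists2 z, Orb phi n z & forall x, S x -> e < pmax p x z.
  apply: contrapT => nz; move: kspan; rewrite ltNge => /negP; apply.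
  apply: ereal_inf_lbound; exists k => //; exists S => //; split=> // y Oy.
  apply: contrapT => ny; apply: nz; exists y => // x Sx.
  by rewrite ltNge; apply/negP => xy; apply: ny; exists x.
have pmaxC x y : pmax p x y = pmax p y x :> R by apply: eq_bigr => i _.
have nSz : ~ S z.
  move=> /zS; rewrite ltNge => /negP; apply.
  by apply/pmax_le => // i; rewrite pxx.
exists (z |` S).
  split=> [x [->|/SO]//|x y [->|Sx] [->|Sy] xy //].
  - by rewrite pmaxC; exact: zS.
  - exact: zS.
  - exact: Ssep.
apply/eq_cardSP; exists z; first by left.
by rewrite classical_sets.setUC classical_sets.setUDK// => _ [-> /nSz].
Qed.

(** Extending separated sets step by step would make the separation number
    infinite if it were smaller than the spanning number. *)
Lemma span_le_sep p e n : 0 <= e -> is_pseudometric p ->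
  (span_number phi p e n <= sep_number phi p e n)%E.
Proof.
move=> e0 pp; rewrite leNgt; apply/negP => lt_sep_span.
have sepk k : exists2 S : set ('I_n -> X), separated_set phi p e S & S #= `I_k.
  elim: k => [|k [S Ssep Sk]].
    by exists set0; [exact: separated_set0|rewrite II0 card_eq00].
  apply: (separated_set_extend e0 pp Ssep Sk).
  apply: le_lt_trans lt_sep_span.
  by apply: ereal_sup_ubound; exists k => //; exists S.
have le_sep k : (k%:R%:E <= sep_number phi p e n)%E.
  by apply: ereal_sup_ubound; exists k => //; exact: sepk.
have : (sep_number phi p e n < +oo)%E by exact: lt_le_trans lt_sep_span (leey _).
have := sep_number_ge0 p e n.
case: (sep_number phi p e n) le_sep => // r le_sep r0 _.
have := le_sep (Num.bound r); rewrite lee_fin leNgt => /negP; apply.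
exact: archi_boundP.
Qed.

Lemma cover_le_span p e A n : 0 <= e ->
  (forall x, exists2 V, A V & forall y, p x y <= e -> V y) ->
  (cover_number phi A n <= span_number phi p e n)%E.
Proof.
move=> e0 leb.
have [V VP] : {V : X -> set X &
    forall x, A (V x) /\ forall y, p x y <= e -> V x y}.
  apply: (choice (P := fun x W => A W /\ forall y, p x y <= e -> W y)) => x.
  by have [V AV pV] := leb x; exists V.
apply/ereal_infP => _ [k [S [SO Sspan] Sk] <-].
pose box (x : 'I_n -> X) : set ('I_n -> X) := [set y | forall i, V (x i) (y i)].
have boxS : box @` S #<= `I_k by rewrite -(card_le_eqr Sk); exact: card_image_le.
have [m boxm] : finite_set (box @` S).
  by apply: card_le_finite boxS _; exact: finite_II.
apply: (@le_trans _ _ m%:R%:E); last first.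
  by rewrite lee_fin ler_nat -card_le_II -(card_le_eql boxm).
apply: ereal_inf_lbound; exists m => //; exists (box @` S) => //; split.
  by move=> _ [x Sx <-]; exists (V \o x) => // i; have [] := VP (x i).
move=> y /Sspan[x Sx xy]; exists (box x); first by exists x.
by move=> i; apply: (VP (x i)).2; move/pmax_le : xy; exact.
Qed.
End Orbits.
End Counting.

Section Lebesgue.
Context {R : realType} {X : topologicalType} {U : set (X -> X -> R)}.
Hypotheses (U_uniformity : is_uniformity U) (U_topology : induces_topology U).

(** The basic balls of the topology may be centred elsewhere; the triangle
    inequality recentres them. *)
Lemma nbhs_pball (x : X) (V : set X) : open V -> V x ->
  exists p r, [/\ U p, 0 < r & pball p x r `<=` V].
Proof.
move=> Vo Vx; have [_ /(_ x)] := U_topology.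
move=> /(_ V)[|B [[p [y [r [Up r0 ->]]]] yx] BV]; first exact: open_nbhs_nbhs.
have [_ _ _ ptri] := uniformity_pseudometric U_uniformity Up.
exists p, (r - p y x); split=> //; first by rewrite subr_gt0.
move=> z xz; apply: BV; rewrite /pball /=.
by apply: le_lt_trans (ptri _ x _) _; rewrite -ltrBrDl.
Qed.

Lemma pball_open p x r : U p -> 0 < r -> open (pball p x r).
Proof. by move=> Up r0; have [+ _] := U_topology; apply; exists p, x, r. Qed.

Lemma open_cover_pball p r : U p -> 0 < r ->
  open_cover [set pball p x r | x in [set: X]].
Proof.
move=> Up r0; have [_ pxx _ _] := uniformity_pseudometric U_uniformity Up.
split=> [_ [x _ <-]|]; first exact: pball_open.
apply/seteqP; split=> // x _; exists (pball p x r); first by exists x.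
by rewrite /pball /= pxx.
Qed.

(** Pairs [(q, m)] with [q] large and [m] small form a filter because the
    uniformity is directed.  Around each point [x], a ball of radius [2 r]
    inside a member of the cover makes every pair [(q, m)] with [p <= q] and
    [m < r] good for the whole ball of radius [r]; compactness, in its form
    about near coverings, yields one pair good everywhere. *)
Lemma lebesgue_number (A : set (set X)) :
  compact [set: X] -> open_cover A ->
  exists p e, [/\ U p, 0 < e &
    forall x, exists2 V, A V & forall y, p x y <= e -> V y].
Proof.
move=> /compact_near_coveringP Xnc [Ao Acov].
pose D : set ((X -> X -> R) * R) := [set q | U q.1 /\ 0 < q.2].
pose above (q : (X -> X -> R) * R) : set ((X -> X -> R) * R) :=
  [set s | [/\ D s, forall x y, q.1 x y <= s.1 x y & s.2 <= q.2]].
have Fflt : Filter (filter_from D above).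
  apply: filter_from_filter.
    by have [p Up] := uniformity_nonempty U_uniformity; exists (p, 1); split.
  move=> [p1 r1] [p2 r2] [/= Up1 r10] [/= Up2 r20].
  exists (fun x y => Num.max (p1 x y) (p2 x y), Num.min r1 r2).
    by split; [exact: uniformity_max|rewrite /= lt_min r10].
  move=> [q m] [Dq /= ge_q]; rewrite le_min => /andP[m1 m2].
  by split; split=> //= x y; have := ge_q x y; rewrite ge_max => /andP[].
pose good (q : (X -> X -> R) * R) (x : X) :=
  exists2 V, A V & forall y, q.1 x y <= q.2 -> V y.
have [x _|[p e] [Up e0] pe_good] := Xnc _ _ good Fflt; last first.
  by exists p, e; split=> // x; apply: (pe_good (p, e)).
have [V AV Vx] : (\bigcup_(V in A) V) x by rewrite Acov.
have [p [r [Up r0 pV]]] := nbhs_pball (Ao _ AV) Vx.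
have [_ pxx _ ptri] := uniformity_pseudometric U_uniformity Up.
have r20 : 0 < r / 2 by rewrite divr_gt0.
exists (pball p x (r / 2), above (p, r / 2)).
  split; last by exists (p, r / 2).
  by apply: open_nbhs_nbhs; split; [exact: pball_open|rewrite /pball /= pxx].
move=> [z [q m]] [/= xz [_ /= pq mr]]; exists V => // y qzy.
apply: pV; rewrite /pball /= (splitr r).
apply: le_lt_trans (ptri _ z _) _; apply: ltr_leD => //.
by apply: le_trans mr; apply: le_trans qzy.
Qed.
End Lebesgue.

Theorem theorem3p21 (R : realType) (X : topologicalType)
    (X_nonempty : [set: X] !=set0)
    (X_compact : compact [set: X])
    (X_hausdorff : hausdorff_space X)
    (U : set (X -> X -> R))
    (U_uniformity : is_uniformity U)
    (U_topology : induces_topology U)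
    (phi : nat -> X -> set X)
    (phi_nonempty : forall (j : nat) (x : X), phi j x !=set0) :
  hKTRT_sep U phi = hAKEK phi /\ hKTRT_span U phi = hAKEK phi.
Proof.
have sep_le : (hKTRT_sep U phi <= hAKEK phi)%E.
  apply/ereal_supP => _ [p [e [Up e0 ->]]].
  have [_ _ psym ptri] := uniformity_pseudometric U_uniformity Up.
  have e20 : 0 < e / 2 by rewrite divr_gt0.
  have cov := open_cover_pball U_uniformity U_topology Up e20.
  apply: le_trans (ereal_sup_ubound _); last by eexists; first exact: cov.
  apply: le_growth_rate => n; first exact: sep_number_ge0.
  apply: sep_le_cover => [|_ y z [x _ <-] xy xz]; first exact: ltW.
  apply: le_trans (ptri _ x _) _; rewrite (splitr e) psym.
  by apply: lerD; exact: ltW.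
have span_le : (hKTRT_span U phi <= hKTRT_sep U phi)%E.
  apply/ereal_supP => _ [p [e [Up e0 ->]]].
  apply: le_trans (ereal_sup_ubound _); last by exists p, e.
  apply: le_growth_rate => n; first exact: span_number_ge0.
  apply: span_le_sep; first exact: ltW.
  exact: (uniformity_pseudometric U_uniformity Up).
have cover_le : (hAKEK phi <= hKTRT_span U phi)%E.
  apply/ereal_supP => _ [A Acov <-].
  have [p [e [Up e0 leb]]] :=
    lebesgue_number U_uniformity U_topology X_compact Acov.
  apply: le_trans (ereal_sup_ubound _); last by exists p, e.
  apply: le_growth_rate => n; first exact: cover_number_ge0.
  by apply: cover_le_span => //; exact: ltW.
by split; apply/le_anti/andP; split=> //; [exact: le_trans cover_le span_le|
  exact: le_trans span_le sep_le].
Qed.
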